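(* There exist constants $\epsilon_*,r_*\in(0,1)$ and nonnegative functions $C(\epsilon,r)$, $\lambda(\epsilon,r)$ and $\widetilde C(\epsilon,r,r_0)$, defined for $\epsilon\in(0,\epsilon_* )$, $r\in(0,r_* )$, $r_0\in(0,1)$ and not depending on the Markov chain, with $$C(\epsilon,r),\ \lambda(\epsilon,r)\longrightarrow 0\ \text{ as }\ \epsilon,r\to0,\qquad \widetilde C(\epsilon,r,r_0)\longrightarrow 0\ \text{ as }\ \epsilon,r,r_0\to 0,$$ such that the following holds. Let $X$ be an irreducible discrete-time Markov chain on a finite state space $\mathcal X$, let $(x_0,G)$ be a reference pair with $T:=\mathbb E\,\tau^{x_0}_G$, and suppose that $(x_0,G)$ satisfies $Rec(R,r)$ with $0<R<T$, $\epsilon:=R/T<\epsilon_*$ and $r<r_*$. Then for every $t>0$, $$\Bigl|\mathbb P\Bigl(\frac{\tau^{x_0}_G}{T}>t\Bigr)-e^{-t}\Bigr|\le C(\epsilon,r)\,e^{-(1-\lambda(\epsilon,r))\,t},$$ and, for every $r_0\in(0,1)$, every $z\in B(x_0,r_0)$ and every $t>0$, $$\Bigl|\mathbb P\Bigl(\frac{\tau^{z}_G}{T}>t\Bigr)-e^{-t}\Bigr|\le \widetilde C(\epsilon,r,r_0)\,e^{-(1-\lambda(\epsilon,r))\,t}.$$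
   Context: $X^x=(X^x_t)_{t\in\mathbb N}$ denotes the chain started at $x\in\mathcal X$ (time starts at $0$). For $F\subset\mathcal X$ the hitting time is $\tau^x_F=\inf\{t\ge0: X^x_t\in F\}$; for a point $y$ write $\tau^x_y=\tau^x_{\{y\}}$. A reference pair $(x_0,G)$ consists of a point $x_0\in\mathcal X$ and a nonempty set $G\subset\mathcal X$; $\{x_0,G\}$ denotes the set $\{x_0\}\cup G$. No reversibility is assumed. Recurrence: for $R>0$ (recurrence time) and $r\in(0,1)$ (recurrence error), the pair $(x_0,G)$ satisfies $Rec(R,r)$ if $\sup_{x\in\mathcal X}\mathbb P(\tau^x_{\{x_0,G\}}>R)\le r$. Basin of attraction of $x_0$ of confidence level $r_0\in(0,1)$: $B(x_0,r_0):=\{x\in\mathcal X:\ \mathbb P(\tau^x_{\{x_0,G\}}=\tau^x_{x_0})>1-r_0\}$.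
   Formalization: The recurrence time is required to satisfy R ≥ 1 instead of R > 0: for 0 < R < 1 the claim is false (two states x_0, y with G = {y} and deterministic swapping give T = 1, Rec(R,r) for all R, r, and ε = R arbitrarily small). *)

(* Defs.v *)
From HB Require Import structures.
From mathcomp Require Import all_boot all_order all_algebra.
From mathcomp Require Import all_classical all_reals all_analysis.
Set Implicit Arguments.
Unset Strict Implicit.
Unset Printing Implicit Defensive.
Import Order.TTheory GRing.Theory Num.Theory.
Import numFieldNormedType.Exports.
Local Open Scope classical_set_scope.
Local Open Scope ring_scope.

Definition stochastic (R : realType) (S : finType) (p : S -> S -> R) : Prop :=
  (forall x y, 0 <= p x y) /\ (forall x, \sum_y p x y = 1).

Fixpoint nstep (R : realType) (S : finType) (p : S -> S -> R) (n : nat)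
    (x y : S) : R :=
  if n is m.+1 then \sum_z p x z * nstep p m z y else (x == y)%:R.

Definition irreducible (R : realType) (S : finType) (p : S -> S -> R) : Prop :=
  forall x y, exists n, 0 < nstep p n x y.

(* The last clause is the Markov property together with homogeneity, in product
   form so that it is meaningful for histories of probability zero. *)
Definition markov_chain_from (R : realType) (S : finType) (p : S -> S -> R)
    (d : measure_display) (Om : measurableType d) (P : probability Om R)
    (x : S) (X : nat -> Om -> S) : Prop :=
  [/\ forall n (A : set S), measurable (X n @^-1` A),
      P [set w | X 0%N w = x] = 1%E &
      forall n (u : nat -> S),
        P [set w | forall k, (k <= n.+1)%N -> X k w = u k] =
        (P [set w | forall k, (k <= n)%N -> X k w = u k]
           * (p (u n) (u n.+1))%:E)%E].

(* The value is +oo on trajectories that never visit F (infimum of set0). *)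
Definition hitting_time (R : realType) (S Om : Type) (X : nat -> Om -> S)
    (F : set S) (w : Om) : \bar R :=
  ereal_inf [set (n%:R%:E : \bar R) | n in [set n | F (X n w)]].

Definition mean_hitting_time (R : realType) (S : Type) (d : measure_display)
    (Om : measurableType d) (P : probability Om R) (X : nat -> Om -> S)
    (F : set S) : \bar R :=
  (\int[P]_w hitting_time R X F w)%E.

(* Below, X x is the chain started at x and P x a probability carrying it: this
   allows both a common P and the canonical family (P_x) on path space. *)

Definition Rec (R : realType) (S : finType) (d : measure_display)
    (Om : measurableType d) (P : S -> probability Om R)
    (X : S -> nat -> Om -> S) (x0 : S) (G : set S) (R0 r : R) : Prop :=
  (ereal_sup
     [set P x [set w | R0%:E < hitting_time R (X x) (x0 |` G) w]
       | x in [set: S]] <= r%:E)%E.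

Definition basin (R : realType) (S : finType) (d : measure_display)
    (Om : measurableType d) (P : S -> probability Om R)
    (X : S -> nat -> Om -> S) (x0 : S) (G : set S) (r0 : R) : set S :=
  [set x | ((1 - r0)%:E <
     P x [set w | hitting_time R (X x) (x0 |` G) w
                  = hitting_time R (X x) [set x0] w])%E].

(* Main.v *)
Require Import Defs.
From HB Require Import structures.
From mathcomp Require Import all_boot all_order all_algebra.
From mathcomp Require Import all_classical all_reals all_analysis.
From mathcomp Require Import measurable_realfun.
From mathcomp Require Import lra ring.
Import Order.TTheory GRing.Theory Num.Theory.
Import numFieldNormedType.Exports.
Local Open Scope classical_set_scope.
Local Open Scope ring_scope.

(** Write [u n] for the probability that the chain started at [x0] avoids [G]
    up to time [n], and [T] for the sum of the [u n], the mean hitting time.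
    The law of the hitting time is close to exponential because [u] is almost
    multiplicative: with [k] close to 1,
    [k * (u s * u t) <= u (s + t)] and [k * u (s + t) <= u s * u t].

    Let [N] be the recurrence time and [r] the recurrence error.  From anywhere
    the chain reaches [x0] or [G] within [N] steps, up to probability [r].
    Two one-sided comparisons follow.  Restarting at that moment, the survival
    probability from any point at time [m + N] is at most [u m] plus [r] times
    the worst survival probability at time [m]
    ([survival_le_reset]).  Conversely, a point from which [x0] is likely to be
    met first survives up to time [t] with probability almost [u t]
    ([survival_ge_hits_first]); a trajectory that survives up to [s + N] is
    typically at such a point at time [s], whence
    [u t * (u (s + N) - r * u s) <= u (s + t)] ([survival_supermul_shift]).
    Summing the first comparison over time bounds the sums of the worst survival
    probabilities by about [T], which forces [u (2 * N)] to be close to 1 as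
    soon as [N] is small compared with [T] ([mean_le_survival]).  So [u] loses
    at most a factor [k + r] over [N] steps ([survival_step]); this is slower
    than the geometric decay in [r] of the trajectories that never recur, so
    that the worst survival probability at any time [t] is at most [u t / k]
    ([survival_uniform]).  Almost multiplicativity is then immediate.

    The logarithm of [u] is thus additive up to a constant, hence lies within
    that constant of a linear function (stability of additive functions, in the
    sense of Hyers and Ulam): [u n] is within a factor [k] of [expR (- (g * n))]
    for some rate [g], uniformly in [n] ([almost_multiplicative_near_exp]).
    This already controls the tail with the right exponential weight, and
    summing over [n] forces [g * T] to be close to 1 ([near_exp_rate]).

    From a point [z] of the basin, survival lies between [(1 - r0 - r) * u n]
    and [u n / k].

    The translation to an arbitrary realisation of the chain rests on the law of
    finite trajectories ([trajectory_prob]) and on writing a hitting time as the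
    sum over [n] of the indicators that it exceeds [n]. *)

(** * Almost multiplicative sequences *)

Lemma partial_sums_le (R : realType) (u : nat -> R) (T : R) :
  (forall n, 0 <= u n) -> (\sum_(n <oo) (u n)%:E = T%:E)%E ->
  forall M, \sum_(0 <= n < M) u n <= T.
Proof.
move=> u0 uT M; rewrite -lee_fin -uT -sumEFin.
by apply: nneseries_lim_ge => n _ _; rewrite lee_fin.
Qed.

Lemma le_of_partial_sums (R : realType) (u : nat -> R) (T B : R) :
  (forall n, 0 <= u n) -> (\sum_(n <oo) (u n)%:E = T%:E)%E ->
  (forall M, \sum_(0 <= n < M) u n <= B) -> T <= B.
Proof.
move=> u0 uT uB; rewrite -lee_fin -uT; apply: lime_le.
  by apply: is_cvg_nneseries => n _ _; rewrite lee_fin.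
by apply: nearW => M; rewrite sumEFin lee_fin.
Qed.

(** The comparison of [a (n * m)] with both [m * a n] and [n * a m] shows that
    every [(a n - l) / n] is below every [(a m + l) / m]; any slope separating
    the two families will do, here the supremum of the first. *)
Lemma almost_additive_near_linear (R : realType) (a : nat -> R) (l : R) :
  (forall s t, `|a (s + t)%N - (a s + a t)| <= l) ->
  exists g, forall n, `|a n - g * n%:R| <= l.
Proof.
move=> al.
have l0 : 0 <= l by apply: le_trans (al 0%N 0%N); exact: normr_ge0.
have amul n m : (0 < m)%N -> `|a (n * m)%N - a n * m%:R| <= l * (m.-1)%:R.
  elim: m => // -[_ _|m IH _]; first by rewrite muln1 !mulr1 subrr normr0 mulr0.
  move: (IH isT) => {}IH; rewrite (mulnS n m.+1) /=.
  have /ler_normlP[h1 h2] := al n (n * m.+1)%N.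
  move/ler_normlP : IH => [h3 h4].
  have e2 : m.+2%:R = m%:R + 1 + 1 :> R by rewrite !natr1.
  have e1 : m.+1%:R = m%:R + 1 :> R by rewrite natr1.
  rewrite e1 in h3 h4; rewrite e2 e1.
  by apply/ler_normlP; split; lra.
(* [m.-1] rather than [m] above leaves room for the two terms [l] here. *)
have cross n m : (0 < n)%N -> (0 < m)%N ->
    (a n - l) / n%:R <= (a m + l) / m%:R.
  move=> n0 m0.
  have n0' : 0 < n%:R :> R by rewrite ltr0n.
  have m0' : 0 < m%:R :> R by rewrite ltr0n.
  rewrite ler_pdivrMr // mulrAC ler_pdivlMr //.
  have /ler_normlP[_ h1] := amul m n n0.
  have /ler_normlP[h2 _] := amul n m m0.
  have e k : (0 < k)%N -> k.-1%:R = k%:R - 1 :> R.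
    by case: k => // k _; rewrite /= -natr1 addrK.
  rewrite mulnC !e// in h1 h2.
  nra.
pose A := [set (a n - l) / n%:R | n in [set n | (0 < n)%N]].
have A0 : A !=set0 by exists ((a 1%N - l) / 1%:R); exists 1%N.
exists (sup A) => -[|n].
  have := al 0%N 0%N; rewrite mulr0 subr0 /= addn0.
  by rewrite opprD addrA subrr add0r normrN.
have n0' : 0 < n.+1%:R :> R by rewrite ltr0n.
apply/ler_normlP; split.
- have : sup A <= (a n.+1 + l) / n.+1%:R.
    by apply: ge_sup => // _ [m /= m0 <-]; exact: cross.
  rewrite ler_pdivlMr //; lra.
- have : (a n.+1 - l) / n.+1%:R <= sup A.
    apply: ub_le_sup; last by exists n.+1.
    by exists ((a 1%N + l) / 1%:R) => _ [m /= m0 <-]; exact: cross.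
  rewrite ler_pdivrMr //; lra.
Qed.

Lemma almost_multiplicative_near_exp (R : realType) (u : nat -> R) (k : R) :
  0 < k -> (forall n, 0 < u n) ->
  (forall s t, k * (u s * u t) <= u (s + t)%N) ->
  (forall s t, k * u (s + t)%N <= u s * u t) ->
  exists g, forall n,
    k * expR (- (g * n%:R)) <= u n /\ k * u n <= expR (- (g * n%:R)).
Proof.
move=> k0 u0 lo up.
have [|g gP] := @almost_additive_near_linear R (fun n => ln (u n)) (- ln k).
  move=> s t; apply/ler_normlP.
  have := lo s t; have := up s t.
  rewrite -ler_ln ?posrE ?mulr_gt0// -[in X in _ -> X -> _]ler_ln ?posrE ?mulr_gt0//.
  by rewrite !lnM ?posrE ?mulr_gt0// => h1 h2; split; lra.
exists (- g) => n; have /ler_normlP[h1 h2] := gP n.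
by split; rewrite -ler_ln ?posrE ?mulr_gt0// ?expR_gt0// lnM ?posrE// ?expR_gt0//
  expRK; lra.
Qed.

(** Summation of the two geometric bounds on [u].  The rate is positive since
    otherwise [u] would be bounded below and its sum infinite. *)
Lemma near_exp_rate (R : realType) (u : nat -> R) (T k g : R) :
  0 < k -> (forall n, 0 <= u n) -> (\sum_(n <oo) (u n)%:E = T%:E)%E ->
  (forall n, k * expR (- (g * n%:R)) <= u n) ->
  (forall n, k * u n <= expR (- (g * n%:R))) ->
  k <= T * (1 - expR (- g)) /\ k * T * (1 - expR (- g)) <= 1.
Proof.
move=> k0 u0 uT lo up; set q := expR (- g).
have qn n : expR (- (g * n%:R)) = q ^+ n.
  by rewrite -expRM_natr mulNr.
have q0 : 0 < q := expR_gt0 _.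
have geo M : (\sum_(0 <= n < M) q ^+ n) * (1 - q) = 1 - q ^+ M.
  by rewrite -[RHS](opprB (q ^+ M)) subrX1 big_mkord mulrC -mulNr opprB.
have lo' M : k * \sum_(0 <= n < M) q ^+ n <= T.
  apply: le_trans (partial_sums_le R u T u0 uT M); rewrite mulr_sumr.
  by apply: ler_sum => n _; rewrite -qn.
have q1 : q < 1.
  rewrite ltNge; apply/negP => q1.
  have {}lo' M : k * M%:R <= T.
    apply: le_trans (lo' M); rewrite ler_pM2l// -[M in leLHS]subn0.
    rewrite -[leLHS]sumr_const_nat; apply: ler_sum => n _; exact: exprn_ege1.
  have := lo' (Num.truncn (T / k)).+1.
  rewrite mulrC -ler_pdivlMr// leNgt => /negP; apply.
  exact: truncnS_gt.
split; last first.
  have : T <= (k * (1 - q))^-1.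
    apply: (le_of_partial_sums R u) => // M.
    rewrite -[leRHS]mul1r ler_pdivlMr ?mulr_gt0 ?subr_gt0// mulrA.
    apply: (@le_trans _ _ (1 - q ^+ M)); last by rewrite gerBl exprn_ge0// ltW.
    rewrite -geo ler_pM2r ?subr_gt0// mulrC mulr_sumr.
    by apply: ler_sum => n _; rewrite -qn.
  rewrite -[leRHS]mul1r ler_pdivlMr ?mulr_gt0 ?subr_gt0//; lra.
have cq : k * (1 - q ^+ n) @[n --> \oo] --> k * (1 - 0).
  apply: cvgMr; apply: cvgB; first exact: cvg_cst.
  by apply: cvg_expr; rewrite ger0_norm// ltW.
rewrite subr0 mulr1 in cq.
rewrite -[leLHS](cvg_lim (@Rhausdorff R) cq).
apply: limr_le; first exact: cvgP cq.
apply: nearW => M.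
by rewrite -geo mulrA ler_pM2r ?subr_gt0.
Qed.

Lemma dist_expR_le (R : realType) (a b m : R) : m <= a -> m <= b ->
  `|expR (- a) - expR (- b)| <= `|a - b| * expR (- m).
Proof.
wlog ab : a b / a <= b => [H|ma mb].
  by case/orP: (le_total a b) => ? ? ?; [|rewrite distrC (distrC a)]; exact: H.
rewrite ger0_norm; last by rewrite subr_ge0 ler_expR lerN2.
rewrite distrC ger0_norm ?subr_ge0//.
apply: (@le_trans _ _ ((b - a) * expR (- a))); last first.
  by rewrite ler_wpM2l ?subr_ge0// ler_expR lerN2.
have -> : expR (- b) = expR (- a) * expR (a - b) by rewrite -expRD; congr expR; ring.
have := expR_ge1Dx (a - b); have := expR_gt0 (- a); nra.
Qed.

(** Here [k] is the multiplicative error, [x] a bound on [1 / T], and [b] bounds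
    at once all the relative errors: that of [u] with respect to the exponential
    of rate [g], that of [g * T] with respect to 1, and the rounding of [t * T]
    to an integer.  The error [b * t] due to the rate is unbounded in [t]; it is
    absorbed by giving up a part [Num.sqrt b] of the exponent, because
    [b * t <= sqrt b * expR (sqrt b * t)]. *)
Lemma near_exp_at_time (R : realType) (u : nat -> R) (T k g x b t : R) :
  0 < T -> 0 < k -> 0 < x -> 1 <= x * T -> 0 <= b < 1 -> k <= 1 ->
  1 <= (1 + b) * (k - x) ->
  (forall n, 0 <= u n) -> (\sum_(n <oo) (u n)%:E = T%:E)%E ->
  (forall n, k * expR (- (g * n%:R)) <= u n) ->
  (forall n, k * u n <= expR (- (g * n%:R))) ->
  0 < t ->
  u (Num.truncn (t * T)) <= (1 + b) * expR (- ((1 - b) * t)) /\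
  `|u (Num.truncn (t * T)) - expR (- t)|
     <= (b + Num.sqrt b) * expR (- ((1 - (b + Num.sqrt b)) * t)).
Proof.
move=> T0 k0 x0 xT /andP[b0 b1] k1 bk u0 uT lo up t0.
have [r1 r2] := near_exp_rate _ _ _ _ _ k0 u0 uT lo up.
set q := expR (- g) in r1 r2.
have q0 : 0 < q := expR_gt0 _.
have kx : x < k by nra.
have qk : k - x <= k * q.
  have q1 : 0 <= 1 - q by nra.
  have : k * (1 - q) <= x.
    have : k * T * (1 - q) <= x * T by exact: le_trans r2 _.
    by rewrite mulrAC ler_pM2r.
  lra.
have g_lo : 1 - b <= g * T.
  have : 1 - q <= g by have := expR_ge1Dx (- g); rewrite -/q; lra.
  move=> h; have : k <= g * T by nra.
  have : (1 - b) * (1 + b) <= 1 by nra.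
  nra.
have qg : q * (1 + g) <= 1.
  have := expR_ge1Dx g; rewrite -(expRxMexpNx_1 g) -/q mulrC; nra.
have g_up : g * T <= 1 + b.
  have : (k * q) * (g * T) <= 1.
    have -> : k * q * (g * T) = k * T * (q * g) by ring.
    apply: le_trans r2; rewrite ler_pM2l ?mulr_gt0//; lra.
  nra.
set n := Num.truncn (t * T).
have tT0 : 0 <= t * T by rewrite mulr_ge0// ltW.
have /andP[n1 n2] : n%:R <= t * T < n.+1%:R by apply: truncn_itv.
have g0 : 0 < g by nra.
set e := expR (- (g * T * t)).
have e0 : 0 < e := expR_gt0 _.
have eq1 : e <= expR (- (g * n%:R)).
  by rewrite ler_expR lerN2 -mulrA ler_pM2l// mulrC.
have eq2 : q * expR (- (g * n%:R)) <= e.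
  rewrite -expRD ler_expR -natr1 in n2 *.
  have : g * (t * T) <= g * (n%:R + 1) by rewrite ler_pM2l// ltW.
  lra.
have un_up : u n <= (1 + b) * e.
  have h1 := up n.
  have : k * q * u n <= e.
    apply: le_trans eq2; rewrite mulrAC mulrC ler_pM2l//.
  have := u0 n; nra.
have un_lo : (1 - b) * e <= u n.
  apply: le_trans (lo n).
  have : 1 - b <= k by nra.
  nra.
have e_le : e <= expR (- ((1 - b) * t)).
  by rewrite ler_expR lerN2 ler_pM2r.
split; first by apply: le_trans un_up _; rewrite ler_pM2l//; lra.
set s := Num.sqrt b; have s0 : 0 <= s := sqrtr_ge0 _.
have sb : s * s = b by rewrite -expr2 sqr_sqrtr.
have h1 : `|u n - e| <= b * expR (- ((1 - b) * t)).
  apply: le_trans (_ : b * e <= _); last by rewrite ler_wpM2l.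
  by apply/ler_normlP; split; lra.
have h2 : `|e - expR (- t)| <= b * t * expR (- ((1 - b) * t)).
  apply: le_trans (dist_expR_le _ _ _ ((1 - b) * t) _ _) _.
  - by rewrite ler_pM2r.
  - by nra.
  rewrite ler_pM2r ?expR_gt0//; apply/ler_normlP; split; nra.
have h3 : expR (- ((1 - b) * t)) <= expR (- ((1 - (b + s)) * t)).
  by rewrite ler_expR; nra.
have h4 : b * t * expR (- ((1 - b) * t)) <= s * expR (- ((1 - (b + s)) * t)).
  have -> : - ((1 - (b + s)) * t) = s * t + - ((1 - b) * t) by ring.
  rewrite expRD mulrA ler_pM2r ?expR_gt0// -sb -mulrA ler_wpM2l//.
  have := expR_ge1Dx (s * t); lra.
have -> : u n - expR (- t) = (u n - e) + (e - expR (- t)) by ring.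
apply: le_trans (ler_normD _ _) _.
have : b * expR (- ((1 - b) * t)) <= b * expR (- ((1 - (b + s)) * t)).
  by rewrite ler_wpM2l.
lra.
Qed.

(** * The chain killed on a set *)

Lemma sum_le_shift (R : realType) (f : nat -> R) (K M : nat) :
  (forall n, 0 <= f n <= 1) ->
  \sum_(0 <= n < M) f n <= K%:R + \sum_(0 <= n < M) f (n + K)%N.
Proof.
move=> f01; apply: (@le_trans _ _ (\sum_(0 <= n < (M + K)%N) f n)).
  rewrite (@big_cat_nat _ _ _ M 0 (M + K)%N)//= ?leq_addr// lerDl.
  by apply: sumr_ge0 => n _; case/andP: (f01 n).
rewrite (@big_cat_nat _ _ _ K 0 (M + K)%N)//= ?leq_addl// -{2}[K]add0n big_addn addnK.
rewrite lerD2r; apply: le_trans (_ : \sum_(0 <= n < K) 1 <= _).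
  by apply: ler_sum => n _; case/andP: (f01 n).
by rewrite sumr_const_nat subn0.
Qed.

Section KilledChain.
Context {R : realType} {S : finType} (p : S -> S -> R).
Hypothesis p_stoch : stochastic p.

(** [killed F n phi x] is the expectation of [phi] at time [n] for the chain
    started at [x], restricted to the event that [F] is avoided at the times
    0 to [n]; [survival F n x] is the probability of that event. *)
Fixpoint killed (F : set S) (n : nat) (phi : S -> R) (x : S) : R :=
  if n is m.+1 then (x \notin F)%:R * \sum_y p x y * killed F m phi y
  else (x \notin F)%:R * phi x.

Definition survival (F : set S) (n : nat) : S -> R := killed F n (fun=> 1).

Lemma killed_in F n phi x : x \in F -> killed F n phi x = 0.
Proof. by case: n => [|n] xF /=; rewrite xF mul0r. Qed.

Lemma killed_notin F n phi x : x \notin F ->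
  killed F n.+1 phi x = \sum_y p x y * killed F n phi y.
Proof. by move=> xF /=; rewrite xF mul1r. Qed.

Lemma killedD F m n phi x : killed F (m + n) phi x = killed F m (killed F n phi) x.
Proof.
elim: m x => [|m IH] x /=.
  by have [xF|xF] := boolP (x \in F); rewrite ?mul1r// mul0r killed_in.
by congr (_ * _); apply: eq_bigr => y _; rewrite -IH.
Qed.

Lemma le_killed F n (phi psi : S -> R) x : (forall y, phi y <= psi y) ->
  killed F n phi x <= killed F n psi x.
Proof.
move=> le; elim: n x => [|n IH] x /=; first by rewrite ler_wpM2l.
rewrite ler_wpM2l//; apply: ler_sum => y _.
by rewrite ler_wpM2l//; case: p_stoch.
Qed.

Lemma killed_lin F n (a b : R) (phi psi : S -> R) x :
  killed F n (fun y => a * phi y + b * psi y) x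
    = a * killed F n phi x + b * killed F n psi x.
Proof.
elim: n x => [|n IH] x /=; first ring.
rewrite (mulrCA a) (mulrCA b) -mulrDr; congr (_ * _).
rewrite !mulr_sumr -big_split /=.
by apply: eq_bigr => y _; rewrite IH /=; ring.
Qed.

Lemma killed_cst F n (a : R) x : killed F n (fun=> a) x = a * survival F n x.
Proof.
rewrite -[RHS]addr0 -[X in _ + X](mul0r (survival F n x)) -killed_lin.
by congr killed; apply/funext => y; rewrite mulr1 mul0r addr0.
Qed.

Lemma survival_ge0 F n x : 0 <= survival F n x.
Proof. by rewrite -[leLHS](mul0r (survival F n x)) -killed_cst; exact: le_killed. Qed.

Lemma survival_le1 F n x : survival F n x <= 1.
Proof.
elim: n x => [|n IH] x; rewrite /survival /=; first by case: (x \in F); rewrite ?mul0r ?mul1r.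
case: (x \in F); rewrite ?mul0r ?mul1r//.
case: p_stoch => p0 p1; rewrite -[leRHS](p1 x); apply: ler_sum => y _.
by rewrite -[leRHS]mulr1 ler_wpM2l//; exact: IH.
Qed.

Lemma survivalD F m n x : survival F (m + n) x = killed F m (survival F n) x.
Proof. exact: killedD. Qed.

Lemma survival_mono F m n x : (m <= n)%N -> survival F n x <= survival F m x.
Proof.
move=> /subnKC <-; rewrite survivalD; apply: le_killed; exact: survival_le1.
Qed.

Lemma survival_le_mul F s t (B : R) x : (forall y, survival F t y <= B) ->
  survival F (s + t) x <= survival F s x * B.
Proof. by move=> tB; rewrite survivalD mulrC -killed_cst; exact: le_killed. Qed.

Lemma step_le x (f g : S -> R) : (forall y, f y <= g y) ->
  \sum_y p x y * f y <= \sum_y p x y * g y.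
Proof. by move=> fg; apply: ler_sum => y _; rewrite ler_wpM2l//; case: p_stoch. Qed.

Section Recurrence.
Context (x0 : S) (G : set S).
Local Notation F := (x0 |` G).
Local Notation u n := (survival G n x0).

Lemma in_reference x : (x \in F) = (x == x0) || (x \in G).
Proof.
rewrite classical_sets.in_setU; congr orb.
by apply/idP/eqP => [/set_mem//|->]; exact: mem_set.
Qed.

(** Either the chain meets [x0] or [G] within [N] steps, and then at most [u m]
    remains for [m] further steps, or it does not, and the bound [B] applies at
    time [N]. *)
Lemma survival_le_reset m N (B : R) x : (forall y, survival G m y <= B) ->
  survival G (m + N) x <= u m + survival F N x * B.
Proof.
move=> mB; have um0 := survival_ge0 G m x0.
have B0 : 0 <= B by apply: le_trans (mB x0).
elim: N x => [|N IH] x.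
  rewrite addn0; have [|] := boolP (x \in F); last first.
    move=> xF; rewrite /survival [killed F _ _ _]/= xF mul1r mul1r.
    by apply: le_trans (mB x) _; rewrite lerDr.
  rewrite in_reference => /orP[/eqP ->|xG].
    by rewrite lerDl mulr_ge0 ?survival_ge0.
  by rewrite {1}/survival killed_in// addr_ge0// mulr_ge0 ?survival_ge0.
have [|] := boolP (x \in F).
  rewrite in_reference => /orP[/eqP ->|xG].
    rewrite -[leLHS]addr0; apply: lerD; first by rewrite survival_mono// leq_addr.
    by rewrite mulr_ge0 ?survival_ge0.
  by rewrite {1}/survival killed_in// addr_ge0// mulr_ge0 ?survival_ge0.
move=> xF; move: (xF); rewrite in_reference negb_or => /andP[_ xG].
rewrite addnS /survival !killed_notin//.
apply: le_trans (step_le _ _ _ IH) _.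
under eq_bigr do rewrite mulrDr mulrA.
rewrite big_split/= -!mulr_suml.
by case: p_stoch => _ ->; rewrite mul1r.
Qed.

(** The probability of visiting [x0] at some time at most [n] without having
    visited [G] earlier. *)
Fixpoint hits_first (n : nat) (x : S) : R :=
  if n is m.+1 then (x == x0)%:R + (x \notin F)%:R * \sum_y p x y * hits_first m y
  else (x == x0)%:R.

Lemma survival_ge_hits_first t N x : x0 \notin G ->
  u t * hits_first N x <= survival G t x.
Proof.
move=> x0G; elim: N x => [|N IH] x /=.
  by have [->|_] := eqVneq x x0; rewrite ?mulr1// mulr0 survival_ge0.
rewrite in_reference; have [->|xx0] := eqVneq x x0; first by rewrite mul0r addr0 mulr1.
have [xG|xG] := boolP (x \in G); first by rewrite mul0r addr0 mulr0 survival_ge0.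
rewrite add0r mul1r; apply: le_trans (survival_mono _ t t.+1 _ _) => //.
rewrite /survival killed_notin// mulr_sumr; under eq_bigr do rewrite mulrCA.
exact: step_le.
Qed.

(** A trajectory that avoids [G] but not [F] up to time [N] has met [x0]. *)
Lemma hits_first_ge N x : survival G N x - survival F N x <= hits_first N x.
Proof.
elim: N x => [|N IH] x.
  rewrite /survival /= in_reference; have [->|xx0] := eqVneq x x0.
    by rewrite mul0r subr0; case: (_ \in _); rewrite ?mul0r ?mul1r.
  by rewrite subrr.
have [->|xx0] := eqVneq x x0.
  rewrite /= in_reference eqxx /= mul0r addr0 [X in _ - X]killed_in ?subr0 ?survival_le1//.
  by rewrite in_reference eqxx.
have [xG|xG] := boolP (x \in G).
  rewrite /= in_reference (negbTE xx0) xG /= /survival !killed_in//; last by rewrite in_reference xG orbT.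
  by rewrite subrr mul0r addr0.
have xF : x \notin F by rewrite in_reference (negbTE xx0).
rewrite /= xF (negbTE xx0) add0r mul1r /survival !killed_notin// -sumrB.
apply: le_trans (step_le _ _ _ IH); apply: ler_sum => y _.
by rewrite mulrBr.
Qed.

(** * Almost multiplicativity of the survival probability *)

Definition max_survival m : R := \big[Order.max/0]_x survival G m x.

Lemma survival_le_max m x : survival G m x <= max_survival m.
Proof. exact: le_bigmax. Qed.

Lemma max_survival_le m (B : R) : 0 <= B -> (forall x, survival G m x <= B) ->
  max_survival m <= B.
Proof. by move=> B0 mB; apply: bigmax_le. Qed.

Lemma max_survival_ge0 m : 0 <= max_survival m.
Proof. by apply: le_trans (survival_le_max m x0); exact: survival_ge0. Qed.

Section Bounds.
Context (N : nat) (r T : R).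
Hypothesis r01 : 0 < r < 1.
Hypothesis rec : forall x, survival F N x <= r.
Hypothesis uT : (\sum_(n <oo) (u n)%:E = T%:E)%E.

Lemma max_survivalD m : max_survival (m + N) <= u m + r * max_survival m.
Proof.
have /andP[r0 _] := r01.
apply: max_survival_le => [|x].
  by rewrite addr_ge0 ?survival_ge0// mulr_ge0 ?max_survival_ge0// ltW.
apply: le_trans (survival_le_reset m N _ x (survival_le_max m)) _.
by rewrite lerD2l ler_wpM2r ?max_survival_ge0.
Qed.

(** The sum is that of [max_survivalD] over [m], the first [N] terms being at
    most 1.  A partial sum is finite, so
    its multiple by [r] can be moved to the left. *)
Lemma sum_max_survival M :
  (1 - r) * \sum_(0 <= m < M) max_survival m <= N%:R + T.
Proof.
have s01 n : 0 <= max_survival n <= 1.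
  rewrite max_survival_ge0/= max_survival_le// => x; exact: survival_le1.
have h := sum_le_shift _ max_survival N M s01.
have : \sum_(0 <= m < M) max_survival (m + N) <=
    \sum_(0 <= m < M) u m + r * \sum_(0 <= m < M) max_survival m.
  by rewrite mulr_sumr -big_split /=; apply: ler_sum => m _; exact: max_survivalD.
have := partial_sums_le _ (fun n => u n) _ (survival_ge0 G ^~ x0) uT M.
lra.
Qed.

(** Conditioning on the position at time [2 * N], the part of the mean hitting
    time beyond [2 * N] is at most [u (2 * N)] times the worst mean hitting
    time.  A window of [2 * N] is what [survival_step] uses: one [N] for
    the step and one for recurrence after it. *)
Lemma mean_le_survival :
  (1 - r) * (T - (2 * N)%:R) <= u (2 * N) * (N%:R + T).
Proof.
have u01 n : 0 <= u n <= 1 by rewrite survival_ge0 survival_le1.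
have r1 : 0 < 1 - r by case/andP: r01 => _; rewrite subr_gt0.
rewrite -ler_pdivlMl// lerBlDl.
apply: (le_of_partial_sums _ _ _ _ (survival_ge0 G ^~ x0) uT) => M.
apply: le_trans (sum_le_shift _ _ (2 * N) M u01) _; rewrite lerD2l ler_pdivlMl//.
have h : \sum_(0 <= n < M) u (n + 2 * N) <=
    u (2 * N) * \sum_(0 <= m < M) max_survival m.
  rewrite mulr_sumr; apply: ler_sum => m _; rewrite addnC.
  by apply: survival_le_mul => y; exact: survival_le_max.
apply: le_trans (_ : (1 - r) * (u (2 * N) * \sum_(0 <= m < M) max_survival m) <= _).
  by rewrite ler_pM2l.
by rewrite mulrCA ler_wpM2l ?survival_ge0// sum_max_survival.
Qed.

(* [k] will be the multiplicative error; [2 * r] pays for one recurrence error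
   in [survival_step] and another one in [survival_uniform]. *)
Context (k : R).
Hypothesis k0 : 0 < k.
Hypothesis N0 : (0 < N)%N.
Hypothesis x0G : x0 \notin G.
Hypothesis uk : k + 2 * r <= u (2 * N).

(** Decomposition at time [s].  The bracket is a lower bound for the probability
    that the chain survives up to [s] and then visits [x0] before [G] within
    [N] steps. *)
Lemma survival_supermul_shift s t : u t * (u (s + N) - r * u s) <= u (s + t).
Proof.
rewrite [in leRHS]survivalD.
apply: le_trans (_ : killed G s (fun y => u t * survival G N y + (- u t) * survival F N y) x0 <= _).
  rewrite killed_lin -survivalD mulrBr mulNr lerD2l lerN2.
  rewrite ler_wpM2l ?survival_ge0// -killed_cst; exact: le_killed.
apply: le_killed => y; rewrite mulNr -mulrBr.
apply: le_trans (survival_ge_hits_first t N y x0G).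
by rewrite ler_wpM2l ?survival_ge0 ?hits_first_ge.
Qed.

Lemma survival_step t : (k + r) * u t <= u (t + N).
Proof.
have := survival_supermul_shift N t.
have -> : (N + N = 2 * N)%N by rewrite mul2n addnn.
rewrite [(N + t)%N]addnC => /(le_trans _); apply.
rewrite mulrC ler_wpM2l ?survival_ge0//.
have /andP[r0 _] := r01; have := survival_le1 G N x0; have := uk; nra.
Qed.

Lemma survival_supermul s t : k * (u s * u t) <= u (s + t).
Proof.
apply: le_trans (survival_supermul_shift s t).
rewrite mulrA [leLHS]mulrC ler_wpM2l ?survival_ge0//.
have := survival_step s; lra.
Qed.

(** Induction by steps of [N].  If survival up to [m] has probability at most
    [u m / k] from every point, then survival up to [m + N] has probability at
    most [(1 + r / k) * u m] by [survival_le_reset], while [u (m + N)] is at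
    least [(k + r) * u m], which is [k] times as much: the bound reproduces
    itself. *)
Lemma survival_uniform t x : k * survival G t x <= u t.
Proof.
elim/ltn_ind: t x => t IH x; have [tN|Nt] := ltnP t N.
  apply: (@le_trans _ _ k); first by rewrite ler_piMr ?survival_le1// ltW.
  apply: le_trans (_ : u (2 * N) <= _); first by move: r01 uk => /andP[? ?]; lra.
  by rewrite survival_mono// (leq_trans (ltnW tN))// leq_pmull.
rewrite -(subnK Nt); set m := (t - N)%N.
have mB y : survival G m y <= u m / k.
  rewrite ler_pdivlMr// mulrC IH//.
  by rewrite /m; case: N N0 Nt => // n _ h; rewrite -subSn// subSS leq_subr.
have h1 := survival_le_reset m N _ x mB.
have h2 := survival_step m; have /andP[r0 _] := r01.
have um0 := survival_ge0 G m x0.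
have h3 : survival F N x * (u m / k) <= r * (u m / k).
  by rewrite ler_wpM2r ?rec// divr_ge0// ltW.
have h4 : survival G (m + N) x <= u m + r * (u m / k) by lra.
rewrite -(ler_pM2l k0) in h4; apply: le_trans h4 _.
rewrite mulrDr mulrCA (mulrCA k) divff ?gt_eqF// mulr1; lra.
Qed.

Lemma survival_submul s t : k * u (s + t) <= u s * u t.
Proof.
rewrite -ler_pdivlMl// mulrCA; apply: survival_le_mul => y.
by rewrite ler_pdivlMl//; exact: survival_uniform.
Qed.

Lemma survival_gt0 n : 0 < u n.
Proof.
have kr : 0 < k + r by case/andP: r01 => r0 _; rewrite addr_gt0.
have h m : 0 < u (m * N).
  elim: m => [|m IH]; first by rewrite /survival /= x0G mul1r.
  rewrite mulSn addnC; apply: lt_le_trans (survival_step _); exact: mulr_gt0.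
apply: lt_le_trans (h n) _; rewrite survival_mono// leq_pmulr//.
Qed.

End Bounds.
End Recurrence.
End KilledChain.

(** * The law of finite trajectories *)

Definition avoids {S : finType} (F : set S) (s : seq S) : bool :=
  all [pred y | y \notin F] s.

Definition trajectory {S Om : Type} (X : nat -> Om -> S) (m n : nat) (w : Om) :
    seq S := [seq X k w | k <- iota m n].

Section PathLaw.
Context {R : realType} {S : finType} (p : S -> S -> R).

(** The probability that the states visited at times 1 to [n] by the chain
    started at [x] form a sequence satisfying [Q].  An arbitrary predicate makes
    the induction of [cylinder_path_prob] go through, since fixing one more
    state turns [Q] into another predicate. *)
Fixpoint path_prob (n : nat) (Q : seq S -> bool) (x : S) : R :=
  if n is m.+1 then \sum_y p x y * path_prob m (fun s => Q (y :: s)) y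
  else (Q [::])%:R.

Lemma eq_path_prob n (Q Q' : seq S -> bool) x : Q =1 Q' ->
  path_prob n Q x = path_prob n Q' x.
Proof.
elim: n Q Q' x => [|n IH] Q Q' x QQ' /=; first by rewrite QQ'.
by apply: eq_bigr => y _; congr (_ * _); apply: IH => s; exact: QQ'.
Qed.

Lemma path_prob_false n x : path_prob n (fun=> false) x = 0.
Proof. by elim: n x => //= n IH x; apply: big1 => y _; rewrite IH mulr0. Qed.

Lemma path_prob_true n x : stochastic p -> path_prob n (fun=> true) x = 1.
Proof.
by case=> _ p1; elim: n x => //= n IH x; under eq_bigr do rewrite IH mulr1.
Qed.

Lemma survival_path_prob F n x :
  survival p F n x = path_prob n (fun s => avoids F (x :: s)) x.
Proof.
elim: n x => [|n IH] x /=; first by rewrite /survival /= mulr1 andbT.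
rewrite /survival /=; case: (x \in F); rewrite /= ?mul0r ?mul1r.
  by rewrite big1// => y _; rewrite path_prob_false mulr0.
by apply: eq_bigr => y _; congr (_ * _); exact: IH.
Qed.

Fixpoint reaches_first (x0 : S) (F : set S) (s : seq S) : bool :=
  if s is x :: s' then (x == x0) || (x \notin F) && reaches_first x0 F s'
  else false.

Lemma hits_first_path_prob x0 G n x : stochastic p ->
  hits_first p x0 G n x
    = path_prob n (fun s => reaches_first x0 (x0 |` G) (x :: s)) x.
Proof.
move=> ps; elim: n x => [|n IH] x; first by rewrite /= andbF orbF.
have [->|xx0] := eqVneq x x0.
  rewrite [LHS]/= in_reference eqxx mul0r addr0 -[LHS](path_prob_true n.+1 x0 ps).
  by apply: eq_path_prob => s /=; rewrite eqxx.
rewrite /= (negbTE xx0) add0r.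
case: (x \in _); rewrite /= ?mul0r ?mul1r.
  by rewrite big1// => y _; rewrite path_prob_false mulr0.
by apply: eq_bigr => y _; congr (_ * _); exact: IH.
Qed.

Context {d : measure_display} {Om : measurableType d} {P : probability Om R}.
Context {x : S} {X : nat -> Om -> S}.
Hypothesis chainX : markov_chain_from p P x X.

Definition cylinder (v : nat -> S) (m : nat) : set Om :=
  [set w | forall k, (k <= m)%N -> X k w = v k].

Lemma measurable_state n y : measurable [set w | X n w = y].
Proof. by case: chainX => mX _ _; exact: (mX n [set y]). Qed.

Lemma split_state n (A : set Om) :
  A = \bigcup_(y in [set: S]) (A `&` [set w | X n w = y]).
Proof. by apply/seteqP; split=> w; [move=> Aw; exists (X n w)|case=> y _ []]. Qed.

Lemma total_probability n (A : set Om) : measurable A ->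
  P A = (\sum_y P (A `&` [set w | X n w = y]))%E.
Proof.
move=> mA; rewrite {1}(split_state n A) measure_fin_bigcup//.
- rewrite (fsbigE (index_enum S)) ?index_enum_uniq//; last first.
    by move=> y _; rewrite mem_index_enum.
  by apply: eq_bigl => y; exact: mem_set.
- exact: finite_finset.
- apply/trivIsetP => y z _ _ yz; apply/seteqP; split=> // w [[_ /= e1] [_ /= e2]].
  by rewrite -e1 -e2 eqxx in yz.
- by move=> y _; apply: measurableI => //; exact: measurable_state.
Qed.

Lemma measurable_cylinder v m : measurable (cylinder v m).
Proof.
have -> : cylinder v m = \bigcap_(k in `I_m.+1) [set w | X k w = v k].
  by apply/seteqP; split=> w /= h k; exact: h.
by apply: fin_bigcap_measurable => // k _; exact: measurable_state.
Qed.

Lemma measurable_trajectory (Q : seq S -> bool) m n :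
  measurable [set w | Q (trajectory X m n w)].
Proof.
elim: n Q m => [|n IH] Q m.
  rewrite /trajectory /=; case: (Q [::]).
    by have -> : [set w : Om | true] = setT by apply/seteqP; split.
  by have -> : [set w : Om | false] = set0 by apply/seteqP; split.
rewrite (split_state m [set w | _]); apply: fin_bigcup_measurable => [|y _]; first exact: finite_finset.
have -> : [set w | Q (trajectory X m n.+1 w)] `&` [set w | X m w = y] =
    [set w | Q (y :: trajectory X m.+1 n w)] `&` [set w | X m w = y].
  by apply/seteqP; split=> w /= [h1 h2]; split=> //; move: h1; rewrite /trajectory /= h2.
by apply: measurableI; [exact: (IH (fun s => Q (y :: s)))|exact: measurable_state].
Qed.

(** Conditioning on the state at time [m.+1] extends the prescribed history by
    one step, which is what the Markov property speaks of. *)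
Lemma cylinder_path_prob n m v (Q : seq S -> bool) :
  P (cylinder v m `&` [set w | Q (trajectory X m.+1 n w)]) =
  (P (cylinder v m) * (path_prob n Q (v m))%:E)%E.
Proof.
elim: n m v Q => [|n IH] m v Q.
  rewrite /trajectory /=; case: (Q [::]).
    have -> : [set w : Om | true] = setT by apply/seteqP; split.
    by rewrite setIT mule1.
  have -> : [set w : Om | false] = set0 by apply/seteqP; split.
  by rewrite setI0 measure0 mule0.
have mA : measurable (cylinder v m `&` [set w | Q (trajectory X m.+1 n.+1 w)]).
  by apply: measurableI; [exact: measurable_cylinder|exact: measurable_trajectory].
rewrite (total_probability m.+1 _ mA).
have fC : P (cylinder v m) \is a fin_num.
  by rewrite fin_num_measure//; exact: measurable_cylinder.
rewrite -(fineK fC) -EFinM /= mulr_sumr -sumEFin; apply: eq_bigr => y _.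
pose v' k := if (k <= m)%N then v k else y.
have v'm : v' m = v m by rewrite /v' leqnn.
have v'S : v' m.+1 = y by rewrite /v' ltnn.
have -> : cylinder v m `&` [set w | Q (trajectory X m.+1 n.+1 w)]
      `&` [set w | X m.+1 w = y] =
    cylinder v' m.+1 `&` [set w | Q (y :: trajectory X m.+2 n w)].
  apply/seteqP; split=> w /=.
    move=> [[h1 h2] h3]; split; last by move: h2; rewrite /trajectory /= h3.
    move=> k; rewrite leq_eqVlt => /orP[/eqP ->|]; first by rewrite v'S.
    by rewrite ltnS /v' => km; rewrite km; exact: h1.
  move=> [h1 h2].
  have e : X m.+1 w = y by rewrite h1// v'S.
  split=> //; split; last by rewrite /trajectory /= e.
  by move=> k km; rewrite h1 ?(leqW km)// /v' km.
rewrite (IH m.+1 v' (fun s => Q (y :: s))) v'S; case: chainX => _ _ mk.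
have -> : P (cylinder v' m.+1) = ((fine (P (cylinder v m)))%:E * (p (v m) y)%:E)%E.
  rewrite /cylinder mk v'm v'S fineK//; congr (P _ * _)%E.
  by apply/seteqP; split=> w /= h k km; rewrite h// /v' km.
by rewrite -!EFinM mulrA.
Qed.

Lemma trajectory_prob n (Q : seq S -> bool) :
  P [set w | Q (trajectory X 0 n.+1 w)] = (path_prob n (fun s => Q (x :: s)) x)%:E.
Proof.
have [_ PX0 _] := chainX.
have mQ := measurable_trajectory Q 0 n.+1.
have m0 := measurable_state 0 x.
transitivity (P ([set w | Q (trajectory X 0 n.+1 w)] `\` [set w | X 0%N w = x]) +
    P ([set w | Q (trajectory X 0 n.+1 w)] `&` [set w | X 0%N w = x]))%E.
  exact: measureDI.
have -> : P ([set w | Q (trajectory X 0 n.+1 w)] `\` [set w | X 0%N w = x]) = 0%E.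
  apply/eqP; rewrite -measure_le0.
  apply: (@le_trans _ _ (P (~` [set w | X 0%N w = x]))).
    by apply: le_measure; rewrite ?inE; [exact: measurableD|exact: measurableC|by move=> w []].
  by rewrite probability_setC// PX0 subee.
rewrite add0e.
have -> : [set w | Q (trajectory X 0 n.+1 w)] `&` [set w | X 0%N w = x] =
    cylinder (fun=> x) 0 `&` [set w | Q (x :: trajectory X 1 n w)].
  apply/seteqP; split=> w /= [h1 h2].
    by split; [case|move: h1; rewrite /trajectory /= h2].
  by have e := h2; have := h1 0%N isT; rewrite /trajectory /= => ->.
rewrite (cylinder_path_prob n 0 (fun=> x) (fun s => Q (x :: s))).
have -> : cylinder (fun=> x) 0 = [set w | X 0%N w = x].
  by apply/seteqP; split=> w /= h; [exact: h|case].
by rewrite PX0 mul1e.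
Qed.

End PathLaw.

(** * Hitting times *)

Section HittingTime.
Context {R : realType} {S : finType} {Om : Type} (X : nat -> Om -> S).

Lemma avoids_trajectoryP F n w :
  reflect (forall k, (k < n)%N -> X k w \notin F) (avoids F (trajectory X 0 n w)).
Proof.
apply: (iffP allP) => /= h.
  by move=> k kn; apply: h; apply: map_f; rewrite mem_iota.
by move=> y /mapP[k]; rewrite mem_iota => kn ->; exact: h.
Qed.

Lemma hitting_time_le F w n : X n w \in F -> (hitting_time R X F w <= n%:R%:E)%E.
Proof. by move=> /set_mem nF; apply: ge_ereal_inf; exists n%:R%:E => //; exists n. Qed.

Lemma le_hitting_time F w n : (forall k, (k < n)%N -> X k w \notin F) ->
  (n%:R%:E <= hitting_time R X F w)%E.
Proof.
move=> h; apply/ereal_infP => _ [k /= kF <-]; rewrite lee_fin ler_nat leqNgt.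
by apply/negP => /h; rewrite mem_set.
Qed.

Lemma lt_hitting_time F w (a : R) : 0 <= a ->
  (a%:E < hitting_time R X F w)%E
    = avoids F (trajectory X 0 (Num.truncn a).+1 w).
Proof.
move=> a0; have /andP[a1 a2] := truncn_itv a0.
apply/idP/avoids_trajectoryP => [h k|h].
  rewrite ltnS => ka; apply/negP => /hitting_time_le /(lt_le_trans h).
  rewrite lte_fin => ak; have : k%:R <= (Num.truncn a)%:R :> R by rewrite ler_nat.
  by move/(lt_le_trans ak)/(le_lt_trans a1); rewrite ltxx.
by apply: lt_le_trans (le_hitting_time _ _ _ h); rewrite lte_fin.
Qed.

Lemma hitting_time_eqn F w n : X n w \in F ->
  (forall k, (k < n)%N -> X k w \notin F) -> hitting_time R X F w = n%:R%:E.
Proof.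
by move=> nF h; apply/eqP; rewrite eq_le hitting_time_le// le_hitting_time.
Qed.

Definition layer F n w : \bar R := (avoids F (trajectory X 0 n.+1 w))%:R%:E.

Lemma hitting_time_layers F w :
  hitting_time R X F w = (\sum_(n <oo) layer F n w)%E.
Proof.
have ge0 n : (0 <= layer F n w)%E by rewrite lee_fin.
rewrite /layer in ge0 *.
have [[n nF]|noF] := pselect (exists n, X n w \in F).
  have [m mF mmin] := ex_minnP (ex_intro (fun n => X n w \in F) n nF).
  have h k : (k < m)%N -> X k w \notin F.
    by move=> km; apply/negP => /mmin; rewrite leqNgt km.
  rewrite (hitting_time_eqn F w m)//.
  rewrite (nneseries_split 0 m)// eseries0 ?adde0; last first.
    move=> i mi _; case: avoids_trajectoryP => // /(_ m).
    by rewrite ltnS mF => /(_ mi).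
  rewrite add0n (eq_big_nat _ _ (F2 := fun=> 1%E)); last first.
    move=> i /andP[_ im]; case: avoids_trajectoryP => // -[] k.
    by rewrite ltnS => ki; apply: h; exact: leq_ltn_trans im.
  by rewrite sumEFin sumr_const_nat subn0.
have {}noF n : X n w \notin F by apply/negP => nF; apply: noF; exists n.
have -> : hitting_time R X F w = +oo%E.
  apply: eq_infty => a; apply: (@le_trans _ _ (Num.truncn a).+1%:R%:E).
    by rewrite lee_fin ltW// truncnS_gt.
  exact: le_hitting_time.
apply/esym/eq_infty => a; apply: (@le_trans _ _ (Num.truncn a).+1%:R%:E).
  by rewrite lee_fin ltW// truncnS_gt.
apply: le_trans (nneseries_lim_ge (Num.truncn a).+1 _) => //.
rewrite sumEFin lee_fin (eq_bigr (fun=> 1)); first by rewrite sumr_const_nat subn0.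
by move=> i _; case: avoids_trajectoryP => // -[].
Qed.

(** If the hitting times of [x0 |` G] and of [x0] agree and are at most [N],
    the state at the first visit to [x0 |` G] is [x0]. *)
Lemma reaches_first_trajectory (x0 : S) (G : set S) w N :
  hitting_time R X (x0 |` G) w = hitting_time R X [set x0] w ->
  ~~ avoids (x0 |` G) (trajectory X 0 N.+1 w) ->
  reaches_first x0 (x0 |` G) (trajectory X 0 N.+1 w).
Proof.
set F := x0 |` G => e /allPn[y /mapP[n + ->]].
rewrite mem_iota /= add0n ltnS => nN /negPn nF.
have [m mF mmin] := ex_minnP (ex_intro (fun n => X n w \in F) n nF).
have h k : (k < m)%N -> X k w \notin F.
  by move=> km; apply/negP => /mmin; rewrite leqNgt km.
have mx0 : X m w = x0.
  apply/eqP/negP => /negP mx0.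
  have : (m.+1%:R%:E <= hitting_time R X [set x0] w)%E.
    apply: le_hitting_time => k; rewrite ltnS leq_eqVlt => /orP[/eqP ->|km].
      by apply/negP => /set_mem /= e'; rewrite e' eqxx in mx0.
    by apply/negP => /set_mem /= e'; have := h k km; rewrite /F in_reference e' eqxx.
  by rewrite -e (hitting_time_eqn F w m)// lee_fin ler_nat ltnn.
have mN : (m <= N)%N by exact: leq_trans (mmin _ nF) nN.
have gen j i : (i <= m)%N -> (m < i + j)%N ->
    reaches_first x0 F (trajectory X i j w).
  elim: j i => [|j IH] i im mj; first by move: mj; rewrite addn0 ltnNge im.
  rewrite /trajectory /=; have [im'|] := boolP (i == m).
    by rewrite (eqP im') mx0 eqxx.
  move=> im'; have im2 : (i < m)%N by rewrite ltn_neqAle im' im.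
  by rewrite (h i im2) IH ?orbT// addSnnS.
by apply: (gen N.+1 0%N).
Qed.

End HittingTime.

Section HittingTimeLaw.
Context {R : realType} {S : finType} (p : S -> S -> R).
Context {d : measure_display} {Om : measurableType d} {P : probability Om R}.
Context {x : S} {X : nat -> Om -> S}.
Hypothesis chainX : markov_chain_from p P x X.

Lemma tail_hitting_time F (a : R) : 0 <= a ->
  P [set w | (a%:E < hitting_time R X F w)%E]
    = (survival p F (Num.truncn a) x)%:E.
Proof.
move=> a0; rewrite survival_path_prob -(trajectory_prob p chainX).
by congr (P _); apply/seteqP; split=> w /=; rewrite lt_hitting_time.
Qed.

Lemma tail_scaled_hitting_time F (T t : R) : 0 < T -> 0 < t ->
  P [set w | (t%:E < hitting_time R X F w / T%:E)%E]
    = (survival p F (Num.truncn (t * T)) x)%:E.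
Proof.
move=> T0 t0; rewrite -tail_hitting_time ?mulr_ge0 ?ltW//.
congr (P _); apply/seteqP; split=> w /=;
  by rewrite inver gt_eqF// lte_pdivlMr.
Qed.

Local Notation layer := (@layer R S Om X).

Lemma layer_indic F n w :
  layer F n w = (\1_[set w | avoids F (trajectory X 0 n.+1 w)] w)%:E.
Proof.
rewrite indicE (_ : (w \in _) = avoids F (trajectory X 0 n.+1 w))//.
by apply/idP/idP => [/set_mem|/mem_set].
Qed.

Lemma measurable_layer F n : measurable_fun [set: Om] (layer F n).
Proof.
rewrite (_ : layer F n = fun w =>
    (\1_[set w | avoids F (trajectory X 0 n.+1 w)] w)%:E).
  apply/measurable_EFinP; apply: measurable_indic.
  exact: (measurable_trajectory p chainX).
by apply/funext => w; exact: layer_indic.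
Qed.

(** Needed to measure the event that two hitting times agree, which defines the
    basin. *)
Lemma measurable_hitting_time F :
  measurable_fun [set: Om] (hitting_time R X F).
Proof.
rewrite (_ : hitting_time R X F = fun w =>
  (\sum_(n <oo) layer F n w)%E).
  apply: ge0_emeasurable_sum => // [n w _ _|n _]; last exact: measurable_layer.
  by rewrite lee_fin.
by apply/funext => w; exact: hitting_time_layers.
Qed.

Lemma mean_hitting_time_sum F :
  mean_hitting_time P X F = (\sum_(n <oo) (survival p F n x)%:E)%E.
Proof.
rewrite /mean_hitting_time.
under eq_integral do rewrite hitting_time_layers.
rewrite integral_nneseries//; last first.
- by move=> n w _; rewrite lee_fin.
- by move=> n; exact: measurable_layer.
apply: eq_eseriesr => n _.
under eq_integral do rewrite layer_indic.
rewrite integral_indic//; last exact: (measurable_trajectory p chainX).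
rewrite setIT survival_path_prob.
exact: (trajectory_prob p chainX n (avoids F)).
Qed.

Lemma basin_hits_first (x0 : S) (G : set S) (N : nat) (r r0 : R) :
  stochastic p -> survival p (x0 |` G) N x <= r ->
  ((1 - r0)%:E < P [set w | hitting_time R X (x0 |` G) w
                           = hitting_time R X [set x0] w])%E ->
  1 - r0 - r <= hits_first p x0 G N x.
Proof.
move=> ps rec bas; set F := x0 |` G in rec bas *.
pose A := [set w | avoids F (trajectory X 0 N.+1 w)].
pose B := [set w | reaches_first x0 F (trajectory X 0 N.+1 w)].
have mA : measurable A by exact: (measurable_trajectory p chainX).
have mB : measurable B by exact: (measurable_trajectory p chainX).
have : ((1 - r0)%:E < P A + P B)%E.
  apply: lt_le_trans bas _.
  apply: le_trans (_ : P (A `|` B) <= _)%E; last exact: measureU2.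
  apply: le_measure; rewrite ?inE.
  - rewrite -[X in measurable X]setTI; apply: measurable_eqe => //;
      exact: measurable_hitting_time.
  - exact: measurableU.
  - move=> w /= e; have [hA|hA] := boolP (avoids F (trajectory X 0 N.+1 w)).
      by left.
    by right; exact: reaches_first_trajectory e hA.
rewrite /A /B !(trajectory_prob p chainX).
rewrite -survival_path_prob -hits_first_path_prob// -EFinD lte_fin.
lra.
Qed.

End HittingTimeLaw.

(** * Convergence to the exponential law *)

(** The constants come from [k = 1 - 3 * (eps + r)], for which
    [mean_le_survival] gives [k + 2 * r <= u (2 * N)]; as [12 * (eps + r) <= 1],
    the inverse of [k - eps] is at most [1 + 6 * (eps + r)]. *)
Lemma survival_near_exponential (R : realType) (S : finType) (p : S -> S -> R)
    (x0 : S) (G : set S) (N : nat) (eps r T t : R) :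
  stochastic p -> x0 \notin G -> (0 < N)%N -> 0 < eps -> 0 < r < 1 ->
  12 * (eps + r) <= 1 -> N%:R <= eps * T -> 1 <= eps * T ->
  (forall x, survival p (x0 |` G) N x <= r) ->
  (\sum_(n <oo) (survival p G n x0)%:E = T%:E)%E -> 0 < t ->
  let b := 6 * (eps + r) in
  let n := Num.truncn (t * T) in
  let rate := 1 - (b + Num.sqrt b) in
  `|survival p G n x0 - expR (- t)| <= (b + Num.sqrt b) * expR (- (rate * t)) /\
  forall z r0, 1 - r0 - r <= hits_first p x0 G N z -> 0 < r0 ->
  `|survival p G n z - expR (- t)|
    <= (b + Num.sqrt b + (b + r0 + r) * (1 + b)) * expR (- (rate * t)).
Proof.
move=> ps x0G N0 e0 r01 er NT eT rec uT t0 b n rate.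
have /andP[r0 r1] := r01.
have T0 : 0 < T by nra.
pose k := 1 - 3 * (eps + r).
have k0 : 0 < k by rewrite /k; lra.
have k1 : k <= 1 by rewrite /k; lra.
have b0 : 0 <= b by rewrite /b; lra.
have b1 : b < 1 by rewrite /b; lra.
have uk : k + 2 * r <= survival p G (2 * N) x0.
  have := mean_le_survival p ps x0 G N r T r01 rec uT.
  have := survival_ge0 p ps G (2 * N) x0; set v := survival _ _ _ _ => v0.
  rewrite natrM => h.
  have h1 : (1 - r) * (T - 2 * (eps * T)) <= v * (eps * T + T).
    apply: le_trans (_ : (1 - r) * (T - 2 * N%:R) <= _).
      by apply: ler_wpM2l; lra.
    by apply: le_trans h _; apply: ler_wpM2l => //; lra.
  have h2 : (1 - r) * (1 - 2 * eps) <= v * (1 + eps).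
    by rewrite -(ler_pM2r T0); move: h1; lra.
  have h3 : (k + 2 * r) * (1 + eps) <= (1 - r) * (1 - 2 * eps) by rewrite /k; nra.
  have e1 : 0 < 1 + eps by lra.
  by rewrite -(ler_pM2r e1); exact: le_trans h3 h2.
have ugt0 := survival_gt0 p ps x0 G N r r01 rec k k0 N0 x0G uk.
have [g gP] := almost_multiplicative_near_exp _ _ k k0 ugt0
  (survival_supermul p ps x0 G N r r01 rec k x0G uk)
  (survival_submul p ps x0 G N r r01 rec k k0 N0 x0G uk).
have bk : 1 <= (1 + b) * (k - eps) by rewrite /b /k; nra.
have [u_up u_exp] := near_exp_at_time _ _ T k g eps b t T0 k0 e0 eT
  (introT andP (conj b0 b1)) k1 bk
  (survival_ge0 p ps G ^~ x0) uT (fun n => (gP n).1) (fun n => (gP n).2) t0.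
split=> // z q hz q0.
set u := survival p G n x0 in u_up u_exp *; set v := survival p G n z.
have u0 : 0 <= u by exact: survival_ge0.
have v0 : 0 <= v by exact: survival_ge0.
have v_up : v <= (1 + b) * u.
  have := survival_uniform p ps x0 G N r r01 rec k k0 N0 x0G uk n z.
  rewrite -/u -/v => kv.
  have b1k : 1 <= (1 + b) * k by apply: le_trans bk _; apply: ler_wpM2l; lra.
  apply: le_trans (_ : (1 + b) * (k * v) <= _); last by apply: ler_wpM2l => //; lra.
  by rewrite mulrA -[leLHS]mul1r ler_wpM2r.
have v_lo : u * (1 - q - r) <= v.
  apply: le_trans (survival_ge_hits_first p ps x0 G n N z x0G).
  by rewrite ler_wpM2l.
have vu : `|v - u| <= (b + q + r) * u by apply/ler_normlP; split; nra.
have -> : v - expR (- t) = (v - u) + (u - expR (- t)) by ring.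
apply: le_trans (ler_normD _ _) _; rewrite mulrDl addrC; apply: lerD => //.
apply: le_trans vu _; rewrite -mulrA; apply: ler_wpM2l; first lra.
apply: le_trans u_up _; apply: ler_wpM2l; first lra.
rewrite ler_expR lerN2; apply: ler_wpM2r; first exact: ltW.
by rewrite lerD2l lerN2 lerDl sqrtr_ge0.
Qed.

Lemma cvg_at_right_id (R : realType) : (fun x : R => x) @ (0 : R)^'+ --> (0 : R).
Proof. exact: cvg_at_right_filter. Qed.

Lemma cvg_add_sqrt (R : realType) (I : Type) (F : set_system I) (f : I -> R) :
  Filter F -> f @ F --> (0 : R) -> f i + Num.sqrt (f i) @[i --> F] --> (0 : R).
Proof.
move=> FF f0; rewrite -[X in _ --> X](addr0 0) -[X in _ --> _ + X]sqrtr0.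
by apply: cvgD => //; apply: continuous_cvg => //; exact: sqrt_continuous.
Qed.

Theorem theorem2p3 (R : realType) :
  exists (eps_star r_star : R) (C lam : R -> R -> R) (Ct : R -> R -> R -> R),
  [/\ 0 < eps_star < 1,
      0 < r_star < 1,
      (forall eps r, 0 < eps < eps_star -> 0 < r < r_star ->
         [/\ 0 <= C eps r, 0 <= lam eps r &
             forall r0, 0 < r0 < 1 -> 0 <= Ct eps r r0]),
      [/\ (fun q : R * R => C q.1 q.2)
            @ filter_prod (0 : R)^'+ (0 : R)^'+ --> (0 : R),
          (fun q : R * R => lam q.1 q.2)
            @ filter_prod (0 : R)^'+ (0 : R)^'+ --> (0 : R) &
          (fun q : R * R * R => Ct q.1.1 q.1.2 q.2)
            @ filter_prod (filter_prod (0 : R)^'+ (0 : R)^'+) (0 : R)^'+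
            --> (0 : R)] &
      forall (S : finType) (p : S -> S -> R)
             (d : measure_display) (Om : measurableType d)
             (P : S -> probability Om R) (X : S -> nat -> Om -> S)
             (x0 : S) (G : set S) (R0 r : R),
        stochastic p -> irreducible p ->
        (forall x, markov_chain_from p (P x) x (X x)) ->
        G !=set0 ->
        (* T is finite by irreducibility *)
        let T := fine (mean_hitting_time (P x0) (X x0) G) in
        let eps := R0 / T in
        (* time is integer-valued, so a recurrence time is at least 1 *)
        1 <= R0 < T -> 0 < r < r_star -> eps < eps_star ->
        Rec P X x0 G R0 r ->
        (forall t, 0 < t ->
           (`| P x0 [set w | t%:E < hitting_time R (X x0) G w / T%:E]
               - (expR (- t))%:E |
            <= (C eps r * expR (- (1 - lam eps r) * t))%:E)%E) /\
        (forall r0 z t, 0 < r0 < 1 -> basin P X x0 G r0 z -> 0 < t ->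
           (`| P z [set w | t%:E < hitting_time R (X z) G w / T%:E]
               - (expR (- t))%:E |
            <= (Ct eps r r0 * expR (- (1 - lam eps r) * t))%:E)%E)].
Proof.
(* The thresholds 1/24 ensure [12 * (eps + r) <= 1]. *)
pose b (e r : R) := 6 * (e + r).
pose C (e r : R) := b e r + Num.sqrt (b e r).
exists (24^-1), (24^-1), C, C, (fun e r r0 => C e r + (b e r + r0 + r) * (1 + b e r)).
have C0 e r : 0 < e -> 0 < r -> 0 <= C e r.
  by move=> e0 r0; rewrite addr_ge0 ?sqrtr_ge0// mulr_ge0// addr_ge0// ltW.
have cb : (fun q : R * R => b q.1 q.2) @ filter_prod (0 : R)^'+ (0 : R)^'+ --> (0 : R).
  rewrite -[X in _ --> X](mulr0 6) -[X in 6 * X](addr0 0).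
  apply: cvgMr; apply: cvgD.
    exact: cvg_comp cvg_fst (@cvg_at_right_id R).
  exact: cvg_comp cvg_snd (@cvg_at_right_id R).
have cC : (fun q : R * R => C q.1 q.2) @ filter_prod (0 : R)^'+ (0 : R)^'+ --> (0 : R).
  exact: cvg_add_sqrt.
split.
- by lra.
- by lra.
- move=> e r /andP[e0 _] /andP[r0 _]; split; [exact: C0|exact: C0|].
  move=> q /andP[q0 _]; rewrite addr_ge0 ?C0// /b mulr_ge0//; lra.
- split=> //.
  rewrite -[X in _ --> X](_ : 0 + (0 + 0 + 0) * (1 + 0) = 0); last by rewrite !(addr0, mul0r).
  have fstP : (fun q : R * R * R => q.1)
      @ filter_prod (filter_prod (0 : R)^'+ (0 : R)^'+) (0 : R)^'+
      --> filter_prod (0 : R)^'+ (0 : R)^'+ by exact: cvg_fst.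
  have cbb := cvg_comp _ _ fstP cb.
  apply: cvgD; first exact: cvg_comp fstP cC.
  apply: cvgM; last by apply: cvgD => //; exact: cvg_cst.
  apply: cvgD.
    by apply: cvgD => //; exact: cvg_comp cvg_snd (@cvg_at_right_id R).
  exact: cvg_comp fstP (cvg_comp _ _ cvg_snd (@cvg_at_right_id R)).
move=> S p d Om P X x0 G R0 r ps _ chain _ T eps /andP[R01 R0T] /andP[r0 rs] es rec.
have T0 : 0 < T by lra.
have meanT : mean_hitting_time (P x0) (X x0) G = T%:E.
  by move: T0; rewrite /T; case: (mean_hitting_time _ _ _) => //=; rewrite ltxx.
have uT := meanT; rewrite (mean_hitting_time_sum p (chain x0)) in uT.
have eps0 : 0 < eps by rewrite divr_gt0//; lra.
have epsT : eps * T = R0 by rewrite divfK// gt_eqF.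
have x0G : x0 \notin G.
  apply/negP => x0G; have : T = 0; last by move=> e; rewrite e ltxx in T0.
  apply: EFin_inj; rewrite -uT eseries0// => n _ _.
  by rewrite /survival killed_in.
pose N := Num.truncn R0.
have R00 : 0 <= R0 by lra.
have N0 : (0 < N)%N by rewrite truncn_gt0.
have NR : N%:R <= R0 by have /andP[] := truncn_itv R00.
have recN x : survival p (x0 |` G) N x <= r.
  rewrite -lee_fin -(tail_hitting_time p (chain x))//.
  apply: le_trans rec; apply: ereal_sup_ubound; by exists x.
have main t (t0 : 0 < t) := survival_near_exponential R S p x0 G N eps r T t
  ps x0G N0 eps0 ltac:(lra) ltac:(lra) ltac:(lra) ltac:(lra) recN uT t0.
split=> [t t0|q z t /andP[q0 q1] bz t0].
  rewrite (tail_scaled_hitting_time p (chain x0))// -EFinB lee_fin mulNr.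
  by have [] := main t t0.
rewrite (tail_scaled_hitting_time p (chain z))// -EFinB lee_fin mulNr.
have [_] := main t t0; apply=> //.
exact: (basin_hits_first p (chain z)).
Qed.
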